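(* Let $R$ be a commutative ring and let $(N,+,\circ)$ be a finite $R$-brace. Let $A=R/\mathrm{Ann}_R(N)$ (a finite ring), and let $A=\bigoplus_{i=1}^t A_i$ be its decomposition into a direct sum of finite local rings, with $A_i$ having residue field isomorphic to $\mathbb F_{p_i^{\lambda_i}}$, $p_i$ prime. Let $e_1,\dots,e_t$ be the corresponding orthogonal idempotents ($e_1+\dots+e_t=1$, $A_i=Ae_i$), and let $N_i=e_iN$, so that $N=\bigoplus_{i=1}^tN_i$ as a group under $+$ and each $N_i$ is a subbrace of $N$. Assume that for some $i\in\{1,\dots,t\}$ $$\mathrm{rank}_{\mathbb Z}(N_i)<\lambda_i(p_i-1).\qquad( * )$$ Then $(N_i,+)$ and $(N_i,\circ)$ have the same number of elements of each order, and if $(N_i,\circ)$ is abelian, then $(N_i,+)\cong(N_i,\circ)$ as groups. If, in addition, $N_1,\dots,N_t$ are ideals of the brace $N$, and $( * )$ holds for all $i$, then $(N,+)$ and $(N,\circ)$ have the same number of elements of each order, and if $(N,\circ)$ is abelian, then $(N,+)\cong(N,\circ)$ as groups.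
   Context: A (left) brace is a set $N$ with two group operations $+$ and $\circ$, with $(N,+)$ abelian, such that $x\circ(y+z)=(x\circ y)-x+(x\circ z)$ for all $x,y,z\in N$. Its gamma function is $x\mapsto\gamma_x$, where $\gamma_x(y)=-x+x\circ y$; each $\gamma_x$ is an automorphism of $(N,+)$. Given a ring $R$, an $R$-brace is a brace $(N,+,\circ)$ such that $(N,+)$ is an $R$-module and every $\gamma_x$ ($x\in N$) is an automorphism of $R$-modules. A subbrace is a subset which is a subgroup of both $(N,+)$ and $(N,\circ)$. An ideal of a brace $N$ is a subset $I$ with $\gamma_x(I)\subseteq I$ for all $x\in N$ which is a normal subgroup of both $(N,+)$ and $(N,\circ)$. Rings have identity and modules are unital. For a finite abelian group $M$, $\mathrm{rank}_{\mathbb Z}M$ is the number of summands in the decomposition of $(M,+)$ as a direct sum of nonzero indecomposable cyclic groups. *)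

(* Defs.v *)
From HB Require Import structures.
From mathcomp Require Import all_boot all_order all_algebra all_fingroup all_solvable.

Set Implicit Arguments.
Unset Strict Implicit.
Unset Printing Implicit Defensive.

Import GRing.Theory.
Local Open Scope ring_scope.
Local Open Scope quotient_scope.

(* In a brace, x + y is the additive structure and the circle operation       *)
(* x \circ y is the product (x * y)%g of the library's groupType structure.   *)
HB.mixin Record isBrace N of GRing.Zmodule N & monoid.Group N := {
  circDr : forall x y z : N,
    (x * (y + z)%R)%g = (x * y)%g - x + (x * z)%g
}.

#[short(type="braceType")]
HB.structure Definition Brace :=
  {N of isBrace N & GRing.Zmodule N & monoid.Group N}.

Definition gamma (N : braceType) (x y : N) : N := - x + (x * y)%g.

HB.mixin Record isRBrace (R : comPzRingType) N
    of Brace N & GRing.Lmodule R N := {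
  gamma_linear : forall x : N, linear (gamma x);
  gamma_bij : forall x : N, bijective (gamma x)
}.

#[short(type="rbraceType")]
HB.structure Definition RBrace (R : comPzRingType) :=
  {N of isRBrace R N & Brace N & GRing.Lmodule R N}.

#[short(type="finBraceType")]
HB.structure Definition FinBrace := {N of Brace N & Finite N}.

(* HB cannot join GRing.Lmodule R and Finite for R : comPzRingType, because   *)
(* finalg's finLmodType asks for a nontrivial ring; hence a plain record.     *)
Record finRBrace (R : comPzRingType) := FinRBrace {
  rbrace_sort :> rbraceType R;
  rbrace_enum : seq rbrace_sort;
  rbrace_enumP : Finite.axiom rbrace_enum
}.

Section FinRBraceInstances.
Variables (R : comPzRingType) (N : finRBrace R).

Fact rbrace_pickleK :
  pcancel (fun x : N => index x (rbrace_enum N)) (onth (rbrace_enum N)).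
Proof.
move=> x; have xN : x \in rbrace_enum N.
  by rewrite -has_pred1 has_count rbrace_enumP.
by rewrite onthE (nth_map x) ?index_mem // nth_index.
Qed.
HB.instance Definition _ := Choice_isCountable.Build N rbrace_pickleK.
HB.instance Definition _ := isFinite.Build N (@rbrace_enumP R N).

End FinRBraceInstances.

(* A finBraceType is, as a finGroupType, the group (N, \circ); the group      *)
(* (N, +) lives on the alias addgrp N, and to_addgrp transports subsets.      *)
Definition addgrp (N : finBraceType) : Type := N.
HB.instance Definition _ (N : finBraceType) := Finite.on (addgrp N).
HB.instance Definition _ (N : finBraceType) :=
  Finite_isGroup.Build (addgrp N) (@addrA N) (@add0r N) (@addNr N).
Definition to_addgrp (N : finBraceType) (S : {set N}) : {set addgrp N} := S.

Definition subbrace (N : finBraceType) (S : {set N}) : bool :=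
  group_set (to_addgrp S) && group_set S.

Definition brace_ideal (N : finBraceType) (I : {set N}) : Prop :=
  [/\ forall x y : N, y \in I -> gamma x y \in I,
      group_set (to_addgrp I) /\ (to_addgrp I <| [set: addgrp N])%g
    & group_set I /\ (I <| [set: N])%g].

(* The library's idealr and {ideal_quot I} only cover proper ideals of        *)
(* nontrivial rings; R may be trivial here and the annihilator may be R.      *)
Record ideal (R : comPzRingType) := Ideal {
  ideal_set :> zmodClosed R;
  idealM : forall a : R, {in ideal_set, forall u, a * u \in ideal_set}
}.

Definition quo_ring (R : comPzRingType) (I : ideal R) : Type :=
  Quotient.quot I.

Section QuotientRing.
Variables (R : comPzRingType) (I : ideal R).
Local Notation Q := (quo_ring I).

HB.instance Definition _ := GRing.Zmodule.on Q.
HB.instance Definition _ := Quotient.on Q.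

Definition quo_pi (x : R) : Q := \pi_(Quotient.quot I) x.
Definition quo_repr (a : Q) : R := generic_quotient.repr (a : Quotient.quot I).
Definition quo_one : Q := quo_pi 1.
Definition quo_mul (a b : Q) : Q := quo_pi (quo_repr a * quo_repr b).

Lemma quo_reprK a : quo_pi (quo_repr a) = a.
Proof. exact: reprK. Qed.

Lemma quo_eqP x y : reflect (quo_pi x = quo_pi y) (x - y \in I).
Proof. by rewrite Quotient.idealrBE; apply: eqP. Qed.

Lemma quo_piB x y : quo_pi (x - y) = quo_pi x - quo_pi y.
Proof. by rewrite /quo_pi raddfB. Qed.

Lemma quo_piD x y : quo_pi (x + y) = quo_pi x + quo_pi y.
Proof. by rewrite /quo_pi raddfD. Qed.

Lemma quo_piM x y : quo_pi (x * y) = quo_mul (quo_pi x) (quo_pi y).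
Proof.
set x' := quo_repr (quo_pi x); set y' := quo_repr (quo_pi y).
have Hx : x - x' \in I by apply/quo_eqP; rewrite quo_reprK.
have Hy : y - y' \in I by apply/quo_eqP; rewrite quo_reprK.
apply/quo_eqP.
have -> : x * y - x' * y' = y * (x - x') + x' * (y - y').
  by rewrite !mulrBr ![y * _]mulrC addrA subrK.
by rewrite rpredD ?idealM.
Qed.

Fact quo_mulA : associative quo_mul.
Proof.
move=> a b c; rewrite -[a]quo_reprK -[b]quo_reprK -[c]quo_reprK.
by rewrite -!quo_piM mulrA.
Qed.
Fact quo_mulC : commutative quo_mul.
Proof. by move=> a b; rewrite /quo_mul mulrC. Qed.
Fact quo_mul1 : left_id quo_one quo_mul.
Proof. by move=> a; rewrite -[a]quo_reprK -quo_piM mul1r. Qed.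
Fact quo_mulD : left_distributive quo_mul +%R.
Proof.
move=> a b c; rewrite -[a]quo_reprK -[b]quo_reprK -[c]quo_reprK.
by rewrite -quo_piD -!quo_piM mulrDl quo_piD.
Qed.

HB.instance Definition _ :=
  GRing.Zmodule_isComPzRing.Build Q quo_mulA quo_mulC quo_mul1 quo_mulD.

Fact quo_pi_zmod : zmod_morphism quo_pi.
Proof. exact: quo_piB. Qed.
Fact quo_pi_monoid : monoid_morphism quo_pi.
Proof. by split=> // x y; rewrite quo_piM. Qed.
HB.instance Definition _ := GRing.isZmodMorphism.Build R Q quo_pi quo_pi_zmod.
HB.instance Definition _ :=
  GRing.isMonoidMorphism.Build R Q quo_pi quo_pi_monoid.

End QuotientRing.

Definition maximal_ideal (R : comPzRingType) (m : ideal R) : Prop :=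
  1 \notin m /\
  forall J : ideal R, {subset m <= J} -> J =i m \/ J =i predT.

(* A ring is local with maximal ideal m when unique_maximal_ideal m holds.    *)
Definition unique_maximal_ideal (R : comPzRingType) (m : ideal R) : Prop :=
  maximal_ideal m /\ forall m' : ideal R, maximal_ideal m' -> m' =i m.

Definition ring_isomorphic (A B : pzRingType) : Prop :=
  exists f : {rmorphism A -> B}, bijective f.

Section Annihilator.
Variables (R : comPzRingType) (N : finRBrace R).

Definition Ann_pred : {pred R} := [pred r : R | [forall x : N, r *: x == 0]].

Fact Ann_zmod_closed : zmod_closed Ann_pred.
Proof.
split=> [|r s /forallP Hr /forallP Hs]; apply/forallP=> x.
  by rewrite scale0r.
by rewrite scalerBl (eqP (Hr x)) (eqP (Hs x)) subrr.
Qed.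
HB.instance Definition _ := GRing.isZmodClosed.Build R Ann_pred Ann_zmod_closed.

Fact AnnM (a : R) : {in Ann_pred, forall u, a * u \in Ann_pred}.
Proof.
move=> u /forallP Hu; apply/forallP=> x.
by rewrite -scalerA (eqP (Hu x)) scaler0.
Qed.
Definition Ann : ideal R := @Ideal R Ann_pred AnnM.

(* The action of R / Ann_R(N) on N induced by that of R.                      *)
Definition quo_scale (a : quo_ring Ann) (x : N) : N := quo_repr a *: x.

Lemma quo_scale_pi (r : R) (x : N) : quo_scale (quo_pi Ann r) x = r *: x.
Proof.
have : quo_repr (quo_pi Ann r) - r \in Ann.
  by apply/quo_eqP; rewrite quo_reprK.
by move=> /forallP/(_ x); rewrite scalerBl subr_eq0 => /eqP.
Qed.

Definition component (e : quo_ring Ann) : {set N} :=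
  [set quo_scale e x | x : N].

End Annihilator.

Record idempotent_elt (A : comPzRingType) := Idempotent {
  idem_val : A;
  idemP : idem_val * idem_val = idem_val
}.

(* The ring A e, with identity e.                                             *)
Section Corner.
Variables (A : comPzRingType) (e : idempotent_elt A).

Definition corner_pred : {pred A} := [pred x : A | x * idem_val e == x].

Lemma cornerP x : reflect (exists a, x = a * idem_val e) (x \in corner_pred).
Proof.
apply: (iffP eqP) => [<-|[a ->]]; first by exists x.
by rewrite -mulrA idemP.
Qed.

Fact corner_zmod_closed : zmod_closed corner_pred.
Proof.
split=> [|x y /eqP Hx /eqP Hy]; first by rewrite inE mul0r.
by rewrite inE mulrBl Hx Hy.
Qed.
HB.instance Definition _ :=
  GRing.isZmodClosed.Build A corner_pred corner_zmod_closed.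

Record corner : Type := Corner {
  corner_val : A;
  corner_valP : corner_val \in corner_pred
}.
HB.instance Definition _ := [isSub for corner_val].
HB.instance Definition _ := [Choice of corner by <:].
HB.instance Definition _ := [SubChoice_isSubZmodule of corner by <:].

Fact corner_one_subproof : idem_val e \in corner_pred.
Proof. by rewrite inE idemP. Qed.
Definition corner_one : corner := Corner corner_one_subproof.

Fact corner_mul_subproof (x y : corner) : corner_val x * corner_val y \in corner_pred.
Proof. by rewrite inE -mulrA (eqP (corner_valP y)). Qed.
Definition corner_mul (x y : corner) : corner :=
  Corner (corner_mul_subproof x y).

Fact corner_mulA : associative corner_mul.
Proof. by move=> x y z; apply: val_inj; rewrite /= mulrA. Qed.
Fact corner_mulC : commutative corner_mul.
Proof. by move=> x y; apply: val_inj; rewrite /= mulrC. Qed.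
Fact corner_mul1 : left_id corner_one corner_mul.
Proof.
by move=> x; apply: val_inj; rewrite /= mulrC (eqP (corner_valP x)).
Qed.
Fact corner_mulD : left_distributive corner_mul +%R.
Proof. by move=> x y z; apply: val_inj; rewrite /= mulrDl. Qed.
HB.instance Definition _ := GRing.Zmodule_isComPzRing.Build corner
  corner_mulA corner_mulC corner_mul1 corner_mulD.

End Corner.

Local Open Scope group_scope.

Definition indecomposable (gT : finGroupType) (G : {set gT}) : bool :=
  (G != 1) && [forall H : {group gT}, forall K : {group gT},
    (H \x K == G) ==> ((H :==: 1) || (K :==: 1))].

(* The factors of a decomposition are nontrivial, hence pairwise distinct, so *)
(* a decomposition can be given as a set of subgroups.                        *)
Definition cyclic_decomposition (gT : finGroupType) (G : {set gT})
    (P : {set {group gT}}) : bool :=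
  (\big[dprod/1]_(H in P) H == G) &&
  [forall H in P, cyclic H && indecomposable H].

Lemma cyclic_decomposition_exists (gT : finGroupType) (G : {group gT}) : abelian G ->
  exists P, cyclic_decomposition G P.
Proof.
have [n] := ubnP #|G|; elim: n G => // n IHn G ltGn cGG.
have [G1|ntG] := eqVneq (G :> {set gT}) 1.
  exists set0; apply/andP; split; first by rewrite big_set0 G1.
  by apply/forall_inP=> H; rewrite inE.
have [indG|] := boolP (indecomposable G).
  exists [set G]; rewrite /cyclic_decomposition big_set1 eqxx /=.
  apply/forall_inP=> H /set1P->; rewrite indG andbT.
  have [[|x b] defG tb] := abelian_structure cGG.
    by case/eqP: ntG; rewrite -defG big_nil.
  have x_gt1 : (1 < #[x])%N.
    by have := abelian_type_gt1 G; rewrite -tb /= => /andP[].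
  move: defG; rewrite big_cons => defG.
  have [[_ K _ defK] _ _ _] := dprodP defG.
  case/andP: indG => _ /forallP/(_ <[x]>%G)/forallP/(_ K).
  rewrite /= -defK defG eqxx /= => /orP[/eqP x1|/eqP K1].
    by rewrite orderE x1 cards1 in x_gt1.
  by rewrite -defG K1 dprodg1 cycle_cyclic.
rewrite /indecomposable ntG /= negb_forall => /existsP[H].
rewrite negb_forall => /existsP[K]; rewrite negb_imply negb_or.
case/and3P=> /eqP defG ntH ntK.
have cardG := dprod_card defG.
have [_ /= mulHK _ tiHK] := dprodP defG.
have H1 : (1 < #|H|)%N by rewrite cardG_gt1.
have K1 : (1 < #|K|)%N by rewrite cardG_gt1.
have sHG : H \subset G by rewrite -mulHK mulG_subl.
have sKG : K \subset G by rewrite -mulHK mulG_subr.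
have [||PH /andP[/eqP dH /forall_inP aH]] := IHn H.
- by rewrite (leq_trans _ (ltGn : (#|G| <= n)%N)) // -cardG ltn_Pmulr // cardG_gt0.
- exact: abelianS cGG.
have [||PK /andP[/eqP dK /forall_inP aK]] := IHn K.
- by rewrite (leq_trans _ (ltGn : (#|G| <= n)%N)) // -cardG ltn_Pmull // cardG_gt0.
- exact: abelianS cGG.
have sub (L : {group gT}) (Q : {set {group gT}}) M :
    \big[dprod/1]_(J in Q) (J : {set gT}) = L -> M \in Q -> M \subset L.
  move=> dL MQ; move: dL; rewrite (bigD1 M) //= => /dprodP[[_ C _ ->] <- _ _].
  exact: mulG_subl.
exists (PH :|: PK); apply/andP; split; last first.
  by apply/forall_inP=> L /setUP[/aH|/aK].
rewrite (eq_bigl [in [predU PH & PK]]); last by move=> L; rewrite !inE.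
rewrite bigU /=; first by rewrite dH dK defG.
rewrite disjoint_subset; apply/subsetP=> L LH; rewrite !inE.
apply/negP=> LK; have /andP[_ /andP[ntL _]] := aH _ LH.
have: L \subset H :&: K by rewrite subsetI (sub _ _ _ dH LH) (sub _ _ _ dK LK).
by rewrite tiHK subG1 (negPf ntL).
Qed.

(* The else branch is never reached on abelian groups, by the lemma above; by *)
(* Krull-Schmidt the value does not depend on the decomposition picked.       *)
Definition rankZ (gT : finGroupType) (G : {set gT}) : nat :=
  if [pick P | cyclic_decomposition G P] is Some P then #|P| else 0.

Definition same_order_counts (gT hT : finGroupType)
    (G : {set gT}) (H : {set hT}) : Prop :=
  forall n : nat, #|[set x in G | #[x] == n]| = #|[set y in H | #[y] == n]|.

(* Main.v *)
From HB Require Import structures.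
Require Import Defs.
From mathcomp Require Import all_boot all_order all_algebra all_fingroup all_solvable.
From mathcomp Require Import finfield boolp.

(** The proof shows more than an equality of order counts: on N_i, and on N
    under the last hypotheses, every single element has the same additive and
    multiplicative order.

    Put d = gamma_x - 1.  In a brace the n-th power of x for the circle operation is
    the norm-like sum x + gamma_x(x) + ... + gamma_x^(n-1)(x), and
    1 + gamma_x + ... + gamma_x^(p-1) is the sum over j < p of binomial(p, j+1) d^j,
    that is, p times a unipotent operator plus d^(p-1).  If d^(p-2) kills the p-torsion
    of N_i, the term d^(p-1) lies deeper than the others, so this operator has exactly
    the p-torsion as its kernel ([norm_map_eq0]); induction on k then shows that the
    p^k-th circle power of x vanishes exactly when p^k x does
    ([order_addgrp_brace]).

    That d^(p-2) kills the p-torsion is where the rank enters.  The p-torsion V of N_i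
    is an A_i-module with p^rank elements, and d acts on it A_i-linearly and
    nilpotently, because (N_i, circle) is a p-group.  The chain V, dV, d^2 V, ...
    decreases strictly until it reaches 0, and each step divides the cardinality by at
    least that of the residue field, since a simple module over a local ring is the
    residue field ([card_simple_factor]).  If d^(p-2) V were not 0, V would have at
    least (p^lambda)^(p-1) elements, against the rank hypothesis
    ([card_unipotent_submodule], [component_torsion]).

    When all the N_i are ideals, N_i acts trivially through gamma on the other
    components, so each projection x |-> e_i x is also a morphism for the circle
    operation ([projM]) and equality of orders passes from the N_i to N.  Finally,
    finite abelian groups with the same number of elements of each order are isomorphic
    ([abelian_isog_same_order_counts]). *)

Set Implicit Arguments.
Unset Strict Implicit.
Unset Printing Implicit Defensive.

Import GRing.Theory.

(** * Abelian groups with the same order counts *)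

Section OrderCountsIsog.
Local Open Scope group_scope.

Lemma same_order_counts_Ldiv (gT hT : finGroupType)
    (G : {group gT}) (H : {group hT}) (n : nat) :
  same_order_counts G H -> #|'Ldiv_n(G)| = #|'Ldiv_n(H)|.
Proof.
move=> cGH.
have part (rT : finGroupType) (K : {group rT}) B : #|K| <= B ->
    #|'Ldiv_n(K)| = \sum_(d < B.+1 | d %| n) #|[set x in K | #[x] == d]|.
  move=> KB; have ltB x : x \in K -> #[x] < B.+1.
    by move=> Kx; apply: leq_trans KB; rewrite dvdn_leq ?order_dvdG.
  rewrite -sum1_card (partition_big (fun x => inord #[x] : 'I_B.+1)
            (fun d : 'I_B.+1 => d %| n)) => [|x]; last first.
    by case/LdivP=> Kx /eqP; rewrite -order_dvdn inordK ?ltB.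
  apply: eq_bigr => d dn; rewrite -sum1_card; apply: eq_bigl => x.
  rewrite !inE -andbA; apply: andb_id2l => Kx.
  rewrite -order_dvdn -val_eqE /= inordK ?ltB //.
  by case: eqP => [->|]; rewrite ?dn ?andbF.
rewrite (part _ _ _ (leq_addr #|H| #|G|)) (part _ _ _ (leq_addl #|G| #|H|)).
by apply: eq_bigr => d _.
Qed.

Lemma card_Ldiv_dprod (gT : finGroupType) (A B G : {group gT}) n :
  A \x B = G -> #|'Ldiv_n(G)| = (#|'Ldiv_n(A)| * #|'Ldiv_n(B)|)%N.
Proof.
case/dprodP=> _ defG cAB tiAB; rewrite -cardsX.
have inj : {in setX A B &, injective (fun u : gT * gT => u.1 * u.2)}.
  move=> [a b] [a' b'] /setXP[/= Aa Bb] /setXP[/= Aa' Bb'] eqm.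
  have eq1 : a'^-1 * a = b' * b^-1.
    by apply: (mulgI a'); apply: (mulIg b); rewrite mulKVg !mulgA mulgKV.
  have : a'^-1 * a \in A :&: B.
    by rewrite inE groupM ?groupV //= eq1 groupM ?groupV.
  rewrite tiAB => /set1P a1; congr (_, _).
    by apply/esym/eqP; rewrite eq_mulVg1 a1.
  by apply/esym/eqP; rewrite eq_mulgV1 -eq1 a1.
have sub : setX 'Ldiv_n(A) 'Ldiv_n(B) \subset setX A B.
  by apply: setXS; apply: subsetIl.
rewrite -(card_in_imset (sub_in2 (subsetP sub) inj)); apply: eq_card => x.
apply/LdivP/imsetP=> [[Gx xn]|[[a b] /setXP[/= /LdivP[Aa an] /LdivP[Bb bn]] ->]].
  move: Gx; rewrite -defG => /mulsgP[a b Aa Bb x_ab].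
  have cab : commute a b by apply/commute_sym/(centsP cAB).
  have abn : a ^+ n * b ^+ n = 1 by rewrite -expgMn // -x_ab.
  have in1 : (1, 1) \in setX A B by rewrite inE !group1.
  have inn : (a ^+ n, b ^+ n) \in setX A B by rewrite inE !groupX.
  have /pair_equal_spec[an bn] : (a ^+ n, b ^+ n) = (1, 1).
    by apply: inj => //=; rewrite abn mulg1.
  by exists (a, b) => //; apply/setXP; split; apply/LdivP.
split; first by rewrite -defG mem_mulg.
have cab : commute a b by apply/commute_sym/(centsP cAB).
by rewrite expgMn // an bn mulg1.
Qed.

Lemma exponent_dvd_card_Ldiv (gT : finGroupType) (G : {group gT}) n :
  (exponent G %| n) = (#|'Ldiv_n(G)| == #|G|).
Proof.
rewrite -sub_LdivT; apply/idP/idP => [/setIidPl -> //|].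
by move=> eqc; apply/setIidPl/eqP; rewrite eqEcard subsetIl (eqP eqc) leqnn.
Qed.

(** These cardinalities determine the exponent of the group.  Splitting off a cyclic
    factor of that order on both sides divides them by the same numbers, so that
    induction applies to the complements. *)
Lemma abelian_isog_card_Ldiv (gT hT : finGroupType)
    (G : {group gT}) (H : {group hT}) :
  abelian G -> abelian H ->
  (forall n, #|'Ldiv_n(G)| = #|'Ldiv_n(H)|) -> G \isog H.
Proof.
have [k] := ubnP #|G|; elim: k => // k IHk in G H * => ltGk cGG cHH cL.
(* If n is a multiple of both group orders, the counts at n are these orders. *)
have full (rT : finGroupType) (K : {group rT}) n :
    #|K| %| n -> #|'Ldiv_n(K)| = #|K|.
  move=> Kn; apply/eqP; rewrite -exponent_dvd_card_Ldiv.
  exact: dvdn_trans (exponent_dvdn K) Kn.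
have cGH : #|G| = #|H|.
  rewrite -(full _ G (#|G| * #|H|)%N) ?dvdn_mulr // cL.
  by rewrite full ?dvdn_mull.
have eqe : exponent G = exponent H.
  apply/eqP; rewrite eqn_dvd.
  rewrite [X in _ && X]exponent_dvd_card_Ldiv -cL -cGH -exponent_dvd_card_Ldiv.
  by rewrite exponent_dvd_card_Ldiv cL cGH -exponent_dvd_card_Ldiv !dvdnn.
have [G1|ntG] := eqVneq (G :> {set gT}) 1.
  rewrite G1 (isog_cyclic_card _ (cyclic1 _)).
  have H1 : #|H| = 1%N by rewrite -cGH G1 cards1.
  by rewrite (card1_trivg H1) cyclic1 !cards1.
(* Elements of maximal order generate direct factors. *)
have [x Gx ex] := exponent_witness (abelian_nil cGG).
have [y Hy ey] := exponent_witness (abelian_nil cHH).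
have /splitsP[G' /complP[tiG defG]] := abelian_splits Gx (esym ex) cGG.
have /splitsP[H' /complP[tiH defH]] := abelian_splits Hy (esym ey) cHH.
have sG'G : G' \subset G by rewrite -defG mulG_subr.
have sH'H : H' \subset H by rewrite -defH mulG_subr.
have dG : <[x]> \x G' = G.
  rewrite dprodE //; apply: subset_trans sG'G _.
  by rewrite (sub_abelian_cent cGG) // cycle_subG.
have dH : <[y]> \x H' = H.
  rewrite dprodE //; apply: subset_trans sH'H _.
  by rewrite (sub_abelian_cent cHH) // cycle_subG.
have isoxy : <[x]> \isog <[y]>.
  by rewrite isog_cyclic_card ?cycle_cyclic //= -!orderE -ex -ey eqe.
apply: (isog_dprod dG dH) => //; apply: IHk.
- rewrite ltnS in ltGk; apply: leq_trans ltGk.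
  rewrite -(dprod_card dG) ltn_Pmull ?cardG_gt0 // -orderE -ex.
  rewrite ltn_neqAle exponent_gt0 andbT eq_sym; apply/negP => /eqP e1.
  by move: ntG; rewrite trivg_exponent e1 dvdnn.
- exact: abelianS cGG.
- exact: abelianS cHH.
move=> n; have := cL n.
rewrite (card_Ldiv_dprod n dG) (card_Ldiv_dprod n dH).
have -> : #|'Ldiv_n(<[x]>)| = #|'Ldiv_n(<[y]>)|.
  have /isogP[f injf fx] := isoxy.
  rewrite -fx -(card_injm injf (subsetIl _ _)); apply: eq_card => z.
  apply/morphimP/LdivP=> [[u ux /LdivP[_ un] ->]|[/morphimP[u ux _ ->] zn]].
    by rewrite mem_morphim // -morphX // un morph1.
  exists u => //; apply/LdivP; split=> //; apply/eqP.
  by rewrite -(morph_injm_eq1 injf) ?groupX // morphX // zn.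
move/eqP; rewrite eqn_pmul2l; first by move/eqP.
by apply/card_gt0P; exists 1; apply/LdivP; rewrite group1 expg1n.
Qed.

Lemma abelian_isog_same_order_counts (gT hT : finGroupType)
    (G : {group gT}) (H : {group hT}) :
  abelian G -> abelian H -> same_order_counts G H -> G \isog H.
Proof.
move=> cGG cHH cGH; apply: abelian_isog_card_Ldiv => // n.
exact: same_order_counts_Ldiv.
Qed.

End OrderCountsIsog.

Local Open Scope ring_scope.

(** * Norm sums of an additive endomorphism *)

Fact iter_zmod_morphism (M : zmodType) (f : {additive M -> M}) n :
  zmod_morphism (iter n f).
Proof. by elim: n => [|n IHn] x y //; rewrite !iterS IHn raddfB. Qed.
HB.instance Definition _ (M : zmodType) (f : {additive M -> M}) n :=
  GRing.isZmodMorphism.Build M M (iter n f) (@iter_zmod_morphism M f n).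

Section Norm.
Variable M : zmodType.
Implicit Types (g d : {additive M -> M}) (y : M).

Lemma iter_raddf0 g n : iter n g 0 = 0.
Proof. exact: raddf0. Qed.

Lemma iter_raddfMn g n y k : iter n g (y *+ k) = iter n g y *+ k.
Proof. exact: raddfMn. Qed.

(** The operator 1 + g + ... + g^(n-1).  In what follows d stands for g - 1, kept as a
    separate variable subject to g z = z + d z. *)
Definition norm_map g n y := \sum_(j < n) iter j g y.

Lemma norm_mapS g n y : norm_map g n.+1 y = y + g (norm_map g n y).
Proof. by rewrite /norm_map big_ord_recl raddf_sum. Qed.

Lemma norm_map_binomial g d n y : (forall z, g z = z + d z) ->
  norm_map g n y = \sum_(j < n) iter j d y *+ 'C(n, j.+1).
Proof.
move=> gE; elim: n => [|n IHn]; first by rewrite /norm_map !big_ord0.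
under eq_bigr => j _ do rewrite binS mulrnDr.
rewrite big_split /= big_ord_recr /= bin_small // mulr0n addr0 -IHn.
rewrite norm_mapS gE addrCA; congr (_ + _).
rewrite big_ord_recl /= bin0 mulr1n; congr (_ + _).
by rewrite IHn raddf_sum; apply: eq_bigr => j _; rewrite raddfMn.
Qed.

Lemma norm_map_telescope g d n y : (forall z, g z = z + d z) ->
  iter n g y = y + d (norm_map g n y).
Proof.
move=> gE; apply: (addIr (norm_map g n y)).
rewrite -addrA [d _ + _]addrC -gE -norm_mapS.
by rewrite /norm_map big_ord_recr /= addrC.
Qed.

Section Prime.
Variables (p : nat) (p_pr : prime p).

Lemma norm_map_torsion g d y : (forall z, g z = z + d z) -> y *+ p = 0 ->
  norm_map g p y = iter p.-1 d y.
Proof.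
move=> gE; case: p p_pr => // k k_pr py0.
rewrite (norm_map_binomial _ _ gE) big_ord_recr /= binn.
rewrite big1 ?add0r // => j _.
have /dvdnP[c ->] : (k.+1 %| 'C(k.+1, j.+1))%N by rewrite prime_dvd_bin ?ltnS ?ltn_ord.
by rewrite mulnC mulrnA -iter_raddfMn py0 iter_raddf0 mul0rn.
Qed.

(** In characteristic p, the identity g^q - 1 = (g - 1)^q for q a power of p; it turns
    the finite order of g into nilpotency of d. *)
Lemma iter_Frobenius g d n y : (forall z, g z = z + d z) -> y *+ p = 0 ->
  iter (p ^ n) g y = y + iter (p ^ n) d y.
Proof.
move=> gE py0; elim: n g d gE => [|n IHn] g d gE; first exact: gE.
have base z : z *+ p = 0 -> iter p g z = z + iter p d z.
  move=> pz0; rewrite (norm_map_telescope _ _ gE) (norm_map_torsion gE) //.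
  by rewrite -iterS prednK ?prime_gt0.
have gpE z : iter p g z = z + (iter p g \- idfun) z by rewrite /= addrC subrK.
rewrite expnSr !iterM (IHn (iter p g) _ gpE); congr (_ + _).
(* The induction hypothesis is about g^p - 1, which is d^p on p-torsion. *)
have step k : iter k (iter p g \- idfun) y = iter k (iter p d) y.
  elim: k => [//|k IHk]; rewrite !iterS IHk.
  apply: (addrI (iter k (iter p d) y)); rewrite -gpE base //.
  by rewrite -iterM -iter_raddfMn py0 iter_raddf0.
exact: step.
Qed.

Variables (S : {pred M}) (g d : {additive M -> M}).
Hypotheses (gE : forall z, g z = z + d z)
           (S_muln : forall y n, y \in S -> y *+ n \in S)
           (S_stable : forall y, y \in S -> d y \in S)
           (S_torsion : forall y, y \in S -> y *+ p = 0 -> iter (p - 2) d y = 0).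

Lemma iter_stable n y : y \in S -> iter n d y \in S.
Proof. by move=> Sy; elim: n => //= n; apply: S_stable. Qed.

(** Multiplication by p^k maps the p^(k+1)-torsion into the p-torsion, so p - 2
    applications of d lower the torsion exponent by one. *)
Lemma difference_nilpotent k y : y \in S -> y *+ p ^ k = 0 ->
  exists s, iter s d y = 0.
Proof.
elim: k y => [|k IHk] y Sy; first by rewrite mulr1n => ->; exists 0%N.
rewrite expnS mulnC mulrnA => /(S_torsion (S_muln _ Sy)).
rewrite iter_raddfMn => /(IHk _ (iter_stable _ Sy))[s].
by rewrite -iterD; exists (s + (p - 2))%N.
Qed.

(** On p-torsion the norm is d^(p-1), which is 0.  Conversely, suppose that the norm
    of y is 0 and that d^(s+1) kills p y.  In d^s applied to the binomial expansion of
    the norm, the middle terms vanish because p divides their coefficients, and the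
    last one, d^(p-2) (d^(s+1) y), because d^(s+1) y is p-torsion; what remains is
    d^s (p y) = 0.  Descending from a large s, one reaches p y = 0. *)
Lemma norm_map_eq0 k y : y \in S -> y *+ p ^ k = 0 ->
  norm_map g p y = 0 <-> y *+ p = 0.
Proof.
move=> Sy /(difference_nilpotent Sy)[s dsy0].
have [q pE] : exists q, p = q.+2.
  by case: p (prime_gt1 p_pr) => [|[|q]] // _; exists q.
have S_torsion' z : z \in S -> z *+ p = 0 -> iter q d z = 0.
  by move=> Sz /S_torsion-/(_ Sz); rewrite pE subn2.
split=> [ny0|py0]; last first.
  by rewrite (norm_map_torsion gE) // pE /= S_torsion' ?raddf0.
have {dsy0} : iter s d (y *+ p) = 0 by rewrite iter_raddfMn dsy0 mul0rn.
elim: s => //= s IHs dspy0; apply: IHs.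
have /(congr1 (iter s d)) := ny0;
  rewrite iter_raddf0 (norm_map_binomial _ _ gE) raddf_sum.
have dz0 : iter s.+1 d y *+ p = 0 by rewrite -iter_raddfMn iterS.
rewrite pE big_ord_recl big_ord_recr /= bin1 -pE big1 ?add0r => [|j _].
  move=> <-; rewrite -[LHS]addr0; congr (_ + _); apply/esym.
  rewrite binn /= mulr1n add0n -iterS -iterD -addSnnS addnC iterD.
  by apply: S_torsion' => //; apply: iter_stable.
have /dvdnP[c ->] : (p %| 'C(p, j.+2))%N.
  by rewrite prime_dvd_bin // pE /= /bump !ltnS ltn_ord.
rewrite /= add0n mulnC mulrnA -iterS !iter_raddfMn -iterD addnS -addSn addnC iterD.
by rewrite -iter_raddfMn dz0 iter_raddf0 mul0rn.
Qed.
End Prime.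
End Norm.

(** * Powers and orders in a brace *)

Section BraceTheory.
Variable N : braceType.
Implicit Types x y z : N.

Lemma circE x y : (x * y)%g = x + gamma x y.
Proof. by rewrite /gamma addNKr. Qed.

Lemma brace1E : (1%g : N) = 0.
Proof.
have := circDr (1%g : N) 0 0; rewrite addr0 !mul1g !addr0 sub0r.
by move=> /esym/eqP; rewrite oppr_eq0 => /eqP.
Qed.

Fact gamma_zmod_morphism x : zmod_morphism (gamma x).
Proof.
move=> y z; apply: (addIr (gamma x z)); rewrite subrK -[in RHS](subrK z y).
by move: (y - z) => w; rewrite /gamma circDr !addrA.
Qed.
HB.instance Definition _ x :=
  GRing.isZmodMorphism.Build N N (gamma x) (gamma_zmod_morphism x).

Lemma gammaM x y z : gamma (x * y)%g z = gamma x (gamma y z).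
Proof.
have := esym (mulgA x y z).
rewrite (circE (x * y)%g z) (circE x (y * z)%g) (circE y z).
by rewrite (raddfD (gamma x)) (addrA x) -(circE x y) => /addrI.
Qed.

Lemma gamma1 z : gamma 1%g z = z.
Proof. by rewrite /gamma mul1g brace1E oppr0 add0r. Qed.

Lemma gammaX x n z : gamma (x ^+ n)%g z = iter n (gamma x) z.
Proof. by elim: n => [|n IHn]; rewrite ?gamma1 // expgS gammaM IHn. Qed.

Lemma circXE x n : (x ^+ n)%g = norm_map (gamma x) n x.
Proof.
elim: n => [|n IHn]; first by rewrite expg0 brace1E /norm_map big_ord0.
by rewrite expgS circE norm_mapS IHn.
Qed.

End BraceTheory.

Section Orders.
Variable N : finBraceType.
Implicit Types (x y : N) (S : {set N}).

Lemma addgrpX x n : ((x : addgrp N) ^+ n)%g = x *+ n.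
Proof. by elim: n => // n IHn; rewrite expgS mulrS IHn. Qed.

Lemma addgrp_group_setP S :
  reflect (0 \in S /\ {in S &, forall x y, x + y \in S}) (group_set (to_addgrp S)).
Proof. by apply: (iffP group_setP). Qed.

Lemma addgrp_order_dvd x n : (#[x : addgrp N]%g %| n)%N = (x *+ n == 0).
Proof. by rewrite order_dvdn addgrpX. Qed.

Lemma brace_order_dvd x n : (#[x]%g %| n)%N = ((x ^+ n)%g == 0).
Proof. by rewrite order_dvdn brace1E. Qed.

Lemma addgrp_group_muln S x n :
  group_set (to_addgrp S) -> x \in S -> x *+ n \in S.
Proof.
by move=> gS Sx; rewrite -addgrpX; have := @groupX _ (Group gS) x n; apply.
Qed.

Lemma addgrp_group_opp S x : group_set (to_addgrp S) -> x \in S -> - x \in S.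
Proof. by move=> gS Sx; have := @groupVr _ (Group gS) x; apply. Qed.

Lemma subbrace_gamma S x y : subbrace S -> x \in S -> y \in S -> gamma x y \in S.
Proof.
case/andP=> aS gS Sx Sy; have [_ SD] := addgrp_group_setP _ aS.
by rewrite SD ?(addgrp_group_opp aS) //; apply: (@groupM _ (Group gS)).
Qed.

(** The p-th circle power of x is the norm of x under gamma_x, and
    multiplication by p^k commutes with that norm; so [norm_map_eq0] applied to p^k x
    reduces the vanishing of the p^(k+1)-th circle power of x to that of p^(k+1) x. *)
Lemma order_addgrp_brace p S :
    prime p -> subbrace S -> (p.-nat #|S|)%N ->
    {in S &, forall x y, y *+ p = 0 -> iter (p - 2) (gamma x \- idfun) y = 0} ->
  {in S, forall x : N, #[x : addgrp N]%g = #[x]%g}.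
Proof.
move=> p_pr sbS pS tor x Sx; have [aS gS] := andP sbS.
have [_ SD] := addgrp_group_setP _ aS.
have [a aE] := p_natP pS.
have xa y : y \in S -> y *+ p ^ a = 0.
  move=> Sy; apply/eqP; rewrite -addgrp_order_dvd -aE.
  exact: (@order_dvdG _ (Group aS)).
have key k y : y \in S -> (y ^+ (p ^ k))%g = 0 <-> y *+ p ^ k = 0.
  elim: k y => [|k IHk] y Sy; first by rewrite expg1.
  have Syp : (y ^+ p)%g \in S by apply: (@groupX _ (Group gS)).
  rewrite expnS expgM; apply: (iff_trans (IHk _ Syp)).
  rewrite circXE /norm_map -sumrMnl mulnC mulrnA.
  under eq_bigr => j _ do rewrite -iter_raddfMn.
  apply: (@norm_map_eq0 _ p p_pr (mem S) _ (gamma y \- idfun) _ _ _ _ a).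
  - by move=> z; rewrite /= addrC subrK.
  - by move=> z n; apply: addgrp_group_muln.
  - move=> z Sz; apply: SD; first exact: subbrace_gamma.
    exact: addgrp_group_opp.
  - by move=> z; apply: tor.
  - exact: addgrp_group_muln.
  by rewrite -mulrnA mulnC mulrnA xa ?mul0rn.
have dvdE k : (#[x : addgrp N]%g %| p ^ k)%N = (#[x]%g %| p ^ k)%N.
  rewrite addgrp_order_dvd brace_order_dvd.
  by apply/eqP/eqP; apply key.
have ppow n : (n %| #|S| -> exists k, n = p ^ k)%N.
  by move=> nS; have [k ->] := p_natP (pnat_dvd nS pS); exists k.
have [|k kE] := ppow #[x : addgrp N]%g.
  exact: (@order_dvdG _ (Group aS)).
have [|l lE] := ppow #[x]%g; first exact: (@order_dvdG _ (Group gS)).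
apply/eqP; rewrite eqn_dvd {2}kE -dvdE -kE dvdnn andbT.
by rewrite lE dvdE -lE dvdnn.
Qed.

End Orders.

Section OrderCounts.
Variables (N : finBraceType) (S : {set N}).

Lemma addgrp_abelian (U : {set addgrp N}) : (abelian U)%g.
Proof. by apply/centsP=> x _ y _; apply: (@addrC N). Qed.

Lemma same_orders_counts_isog : subbrace S ->
    {in S, forall x : N, #[x : addgrp N]%g = #[x]%g} ->
  same_order_counts (to_addgrp S) S /\
  ((abelian S)%g -> (to_addgrp S \isog S)%g).
Proof.
move=> /andP[aS gS] eqo; have cnt : same_order_counts (to_addgrp S) S.
  move=> n; apply: eq_card => x; rewrite !inE; apply: andb_id2l => Sx.
  by rewrite -(eqo x Sx).
split=> // cSS.
apply: (@abelian_isog_same_order_counts _ _ (Group aS) (Group gS)) => //.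
exact: addgrp_abelian.
Qed.

End OrderCounts.

(** * Finite modules over a local ring *)

Section LocalModules.
Variables (B : comPzRingType) (M : finZmodType) (act : B -> {additive M -> M}).
Hypothesis actB : forall a b x, act (a - b) x = act a x - act b x.
Hypothesis actM : forall a b x, act (a * b) x = act a (act b x).
Implicit Types (V W : {set M}).

Lemma act0 x : act 0 x = 0.
Proof. by have := actB 0 0 x; rewrite !subrr. Qed.

Lemma actD a b x : act (a + b) x = act a x + act b x.
Proof. by rewrite -[b in LHS]opprK actB -sub0r actB act0 sub0r opprK. Qed.

(** The action need not be unital on M, only on the submodule: the unit e of a corner
    ring A e acts on the whole A-module as the projection onto the component of e. *)
Definition submodule V : Prop :=
  [/\ 0 \in V, {in V &, forall x y, x - y \in V},
      forall a, {in V, forall x, act a x \in V}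
    & {in V, forall x, act 1 x = x}].

Lemma submoduleN V x : submodule V -> x \in V -> - x \in V.
Proof. by case=> V0 VB _ _ Vx; rewrite -sub0r VB. Qed.

Lemma submoduleD V x y : submodule V -> x \in V -> y \in V -> x + y \in V.
Proof.
move=> sV Vx Vy; rewrite -[y]opprK.
by case: (sV) => _ -> //; rewrite submoduleN.
Qed.

Lemma submodule_muln V x n : submodule V -> x \in V -> x *+ n \in V.
Proof.
move=> sV Vx; elim: n => [|n IHn]; first by case: sV.
by rewrite mulrS submoduleD.
Qed.

Lemma act_natr V x n : submodule V -> x \in V -> act n%:R x = x *+ n.
Proof.
case=> _ _ _ V1 Vx; elim: n => [|n IHn]; first exact: act0.
by rewrite -natr1 actD IHn V1 // mulrSr.
Qed.

Lemma submodule0 : submodule [set 0].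
Proof.
split=> [|x y /set1P-> /set1P->|a x /set1P->|x /set1P->].
- exact: set11.
- by rewrite subrr set11.
- by rewrite raddf0 set11.
- by rewrite raddf0.
Qed.

Lemma submodule_imset (f : {additive M -> M}) V :
  (forall a x, f (act a x) = act a (f x)) -> submodule V -> submodule (f @: V).
Proof.
move=> fZ [V0 VB VZ V1]; split.
- by apply/imsetP; exists 0; rewrite ?raddf0.
- move=> _ _ /imsetP[x Vx ->] /imsetP[y Vy ->].
  by apply/imsetP; exists (x - y); rewrite ?raddfB ?VB.
- by move=> a _ /imsetP[x Vx ->]; rewrite -fZ imset_f ?VZ.
- by move=> _ /imsetP[x Vx ->]; rewrite -fZ V1.
Qed.

Section Conductor.
Variables (W : {set M}) (sW : submodule W) (v : M).

Definition conductor_pred : {pred B} := [pred a | act a v \in W].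

Fact conductor_zmod_closed : zmod_closed conductor_pred.
Proof.
split=> [|a b]; rewrite !inE; last by rewrite actB; case: sW => _ WB _ _; apply: WB.
by rewrite act0; case: sW.
Qed.
HB.instance Definition _ :=
  GRing.isZmodClosed.Build B conductor_pred conductor_zmod_closed.

Fact conductorM a : {in conductor_pred, forall b, a * b \in conductor_pred}.
Proof. by move=> b; rewrite !inE actM; case: sW => _ _ WZ _; apply: WZ. Qed.

Definition conductor : ideal B := @Ideal B conductor_pred conductorM.

Lemma conductorE a : (a \in conductor) = (act a v \in W).
Proof. by []. Qed.

End Conductor.

Variables (m : ideal B) (m_max : unique_maximal_ideal m).

(** A vector v of V outside W for which B v + W is as small as possible spans a simple
    submodule of V / W; its annihilator is then a maximal ideal, hence the only
    one. *)
Lemma exists_simple_factor V W :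
    submodule V -> submodule W -> W \proper V ->
  exists2 v, v \in V :\: W & forall a, (act a v \in W) = (a \in m).
Proof.
move=> sV sW /properP[sWV [v0 Vv0 Wv0]].
pose span v : {set M} := [set y | `[< exists a, y - act a v \in W >]].
have D0 : v0 \in V :\: W by rewrite inE Wv0.
case: (arg_minnP (fun v => #|span v|) D0) => v /setDP[Vv Wv] v_min.
exists v; first by rewrite inE Wv.
suff max_v : maximal_ideal (conductor sW v).
  by move=> a; rewrite -(conductorE sW) (m_max.2 _ max_v).
have [_ _ VZ V1] := sV; have [W0 WB WZ _] := sW.
split=> [|J sIJ]; first by rewrite conductorE V1.
(* If j v is not in W, minimality gives B (j v) + W = B v + W, so v = a j v modulo W
   for some a, and 1 - a j lies in the annihilator, hence in J. *)
have [[j [Jj Wj]]|noJ] := pselect (exists j, j \in J /\ act j v \notin W).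
  right; suff J1 : 1 \in J by move=> a; rewrite -[a]mulr1 idealM.
  have Djv : act j v \in V :\: W by rewrite inE Wj VZ.
  have sub : span (act j v) \subset span v.
    apply/subsetP=> y; rewrite !inE => /asboolP[a Wa].
    by apply/asboolP; exists (a * j); rewrite actM.
  have : v \in span v.
    by rewrite inE; apply/asboolP; exists 1; rewrite V1 // subrr.
  have /eqP<- : span (act j v) == span v by rewrite eqEcard sub v_min.
  rewrite inE => /asboolP[a Wa].
  have : 1 - a * j \in J by apply: sIJ; rewrite conductorE actB actM V1.
  by move=> J1; rewrite -(subrK (a * j) 1) rpredD ?idealM.
left=> a; apply/idP/idP=> [Ja|/sIJ //]; rewrite conductorE.
by apply: contra_notT noJ => Wa; exists a.
Qed.

Variables (F : finFieldType) (mF : ring_isomorphic (quo_ring m) F).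

(** V / W contains a copy of the residue field. *)
Lemma card_simple_factor V W :
  submodule V -> submodule W -> W \proper V -> (#|F| * #|W| <= #|V|)%N.
Proof.
move=> sV sW pWV; have [v /setDP[Vv _] vm] := exists_simple_factor sV sW pWV.
have [f [h fK hK]] := mF; have [_ _ VZ _] := sV; have [_ WB _ _] := sW.
pose lift (u : F * M) := act (quo_repr (h u.1)) v + u.2.
have lift_inj : {in setX [set: F] W &, injective lift}.
  move=> [c w] [c' w'] /setXP[_ /= Ww] /setXP[_ /= Ww'] /eqP.
  rewrite /lift /= -subr_eq0 opprD addrACA -actB addr_eq0 opprB => /eqP eqw.
  have : act (quo_repr (h c) - quo_repr (h c')) v \in W by rewrite eqw WB.
  rewrite vm => /quo_eqP; rewrite !quo_reprK => /(can_inj hK) cc'.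
  move: eqw; rewrite cc' actB subrr => /esym/eqP.
  by rewrite subr_eq0 => /eqP->.
rewrite -cardsT -cardsX -(card_in_imset lift_inj); apply/subset_leq_card/subsetP.
move=> _ /imsetP[[c w] /setXP[_ /= Ww] ->].
apply: (submoduleD sV); first exact: VZ.
exact: (subsetP (proper_sub pWV)).
Qed.

Variables (p lambda : nat) (p_pr : prime p) (cardF : #|F| = (p ^ lambda)%N).

Lemma residue_char_in_maximal : p%:R \in m.
Proof.
have [f [h fK hK]] := mF.
have p0 : (p%:R : F) = 0 by rewrite (pcharf0 (card_finPcharP cardF p_pr)).
rewrite -[p%:R]subr0; apply/quo_eqP; apply: (can_inj fK).
by rewrite raddf0 rmorph0 !rmorph_nat.
Qed.

(** The elements of V killed by n form a submodule, in which a nonzero simple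
    submodule would be killed both by n and by p, as p lies in the maximal ideal. *)
Lemma submodule_ptorsion V a n : submodule V -> coprime p n ->
    {in V, forall x, x *+ (p ^ a * n) = 0} -> {in V, forall x, x *+ p ^ a = 0}.
Proof.
move=> sV co_pn Van x Vx; have [V0 VB VZ V1] := sV.
pose U := [set y in V | y *+ n \in [set 0]].
have sU : submodule U.
  split=> [|y z|b y|y]; rewrite !inE ?V0 ?mul0rn //=.
  - move=> /andP[Vy /eqP yn] /andP[Vz /eqP zn].
    by rewrite VB //= mulrnBl yn zn subrr.
  - by move=> /andP[Vy /eqP yn]; rewrite VZ //= -raddfMn yn raddf0.
  by move=> /andP[/V1].
have Uxa : x *+ p ^ a \in U.
  by rewrite !inE (submodule_muln _ sV) //= -mulrnA Van.
apply/eqP/negPn/negP=> xa_neq0.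
have pU : [set 0] \proper U.
  apply/properP; split; first by rewrite sub1set; case: sU.
  by exists (x *+ p ^ a); rewrite // inE.
have [v /setDP[Uv nz_v] vm] := exists_simple_factor sU submodule0 pU.
case/negP: nz_v; have [Vv /set1P vn] := setIdP Uv.
have /set1P vp : v *+ p \in [set 0].
  by rewrite -(act_natr _ sV) // vm residue_char_in_maximal.
rewrite !inE -[v]mulr1n; have [[k l] el1] := coprimeP n (prime_gt0 p_pr) co_pn.
rewrite -[X in _ *+ X]el1.
have lek : (l * n <= k * p)%N.
  by rewrite leqNgt; apply/negP=> /ltnW; rewrite -subn_eq0 => /eqP; rewrite el1.
by rewrite mulrnBr // ![(_ * p)%N]mulnC ![(_ * n)%N]mulnC !mulrnA vp vn !mul0rn subrr.
Qed.

(** As d is nilpotent, d V is a proper submodule of V as long as V is not 0, so each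
    application of d costs a factor #|F|. *)
Lemma card_unipotent_submodule (d : {additive M -> M}) N s V x :
    (forall a x, d (act a x) = act a (d x)) ->
    submodule V -> {in V, forall x, d x \in V} ->
    {in V, forall x, iter N d x = 0} ->
  x \in V -> iter s d x != 0 -> (#|F| ^ s.+1 <= #|V|)%N.
Proof.
move=> dZ; elim: s V x => [|s IHs] V x sV dV nil Vx dx_neq0.
  rewrite expn1 -[#|F|]muln1 -(cards1 (0 : M)); apply: card_simple_factor => //.
    exact: submodule0.
  apply/properP; split; first by rewrite sub1set; case: sV.
  by exists x; rewrite // inE.
have sdV : d @: V \subset V by apply/subsetP=> _ /imsetP[y Vy ->]; apply: dV.
have pdV : d @: V \proper V.
  rewrite properEneq sdV andbT; apply/eqP=> dVE.
  have preim n : exists2 y, y \in V & x = iter n d y.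
    elim: n => [|n [y Vy ->]]; first by exists x.
    by move: Vy; rewrite -{1}dVE => /imsetP[z Vz ->]; exists z; rewrite // -iterSr.
  have [y Vy xE] := preim N; by move: dx_neq0; rewrite xE nil // iter_raddf0 eqxx.
rewrite expnS; apply: leq_trans (card_simple_factor sV (submodule_imset dZ sV) pdV).
rewrite leq_mul2l (IHs _ (d x)) ?orbT //.
- exact: submodule_imset.
- by move=> _ /imsetP[y Vy ->]; rewrite imset_f ?dV.
- by move=> _ /imsetP[y Vy ->]; apply: nil; apply: dV.
- by rewrite imset_f.
by rewrite -iterSr.
Qed.

End LocalModules.

(** * The rank of an abelian p-group *)

Section RankZ.
Local Open Scope group_scope.
Variables (gT : finGroupType) (p : nat).

Lemma p_rank_bigdprod (I : Type) (r : seq I) (Q : pred I) (H : I -> {group gT})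
    (G : {group gT}) :
  \big[dprod/1]_(i <- r | Q i) H i = G ->
  'r_p(G) = (\sum_(i <- r | Q i) 'r_p(H i))%N.
Proof.
elim: r G => [|i r IHr] G; rewrite ?big_nil ?big_cons.
  by move=> G1; rewrite -G1 p_rank1.
case: (Q i) => [defG|]; last exact: IHr.
have [[_ K _ defK] _ _ _] := dprodP defG.
by rewrite -(IHr _ defK) (p_rank_dprod p (_ : H i \x K = G)) // -defK.
Qed.

(** Each factor of a cyclic decomposition is a nontrivial cyclic p-group, hence of
    p-rank 1, and p-ranks add up over direct products. *)
Lemma p_rank_rankZ (G : {group gT}) :
  p.-group G -> abelian G -> 'r_p(G) = rankZ G.
Proof.
move=> pG cGG; rewrite /rankZ; case: pickP => [P|noP]; last first.
  by have [P] := cyclic_decomposition_exists cGG; rewrite noP.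
case/andP=> /eqP defG /forall_inP cycP.
rewrite (p_rank_bigdprod defG) -sum1_card; apply: eq_bigr => H PH.
have /andP[/cyclicP[x defH] /andP[ntH _]] := cycP H PH.
have sHG : H \subset G.
  move: defG; rewrite (bigD1 H) //= => /dprodP[[_ K _ ->] <- _ _].
  exact: mulG_subl.
rewrite -(rank_pgroup (pgroupS sHG pG)) defH rank_cycle.
by rewrite defH cycle_eq1 in ntH; rewrite ntH.
Qed.

Lemma card_Ldiv_rankZ (G : {group gT}) :
  p.-group G -> abelian G -> #|'Ldiv_p(G)| = (p ^ rankZ G)%N.
Proof.
move=> pG cGG; have cOO : abelian 'Ohm_1(G) by apply: abelianS (Ohm_sub 1 G) cGG.
rewrite -(p_rank_rankZ pG cGG) p_rank_abelian //.
rewrite -[p in 'Ldiv_p(_)]expn1 -(OhmEabelian pG cOO).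
by rewrite -(card_pgroup (pgroupS (Ohm_sub 1 G) pG)).
Qed.

End RankZ.

(** * The component of a local idempotent *)

Section QuotientAction.
Variables (R : comPzRingType) (N : finRBrace R).
Local Notation A := (quo_ring (Ann N)).
Implicit Types (a b : A) (x y : N).

Fact quo_scale_zmod_morphism a : zmod_morphism (@quo_scale R N a).
Proof. by move=> x y; rewrite /quo_scale scalerBr. Qed.
HB.instance Definition _ a :=
  GRing.isZmodMorphism.Build N N (@quo_scale R N a) (quo_scale_zmod_morphism a).

Lemma quo_scaleBl a b x : quo_scale (a - b) x = quo_scale a x - quo_scale b x.
Proof.
rewrite -[a]quo_reprK -[b]quo_reprK -quo_piB.
by rewrite !quo_scale_pi scalerBl.
Qed.

Lemma quo_scaleM a b x : quo_scale (a * b) x = quo_scale a (quo_scale b x).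
Proof.
by rewrite -[a]quo_reprK -[b]quo_reprK -rmorphM !quo_scale_pi scalerA.
Qed.

Lemma quo_scale1 x : quo_scale 1 x = x.
Proof. by rewrite (quo_scale_pi (1 : R)) scale1r. Qed.

Lemma quo_scale0 x : quo_scale 0 x = 0.
Proof. by rewrite -(subrr 0) quo_scaleBl subrr. Qed.

Lemma quo_scale_sum (I : finType) (a : I -> A) x :
  quo_scale (\sum_i a i) x = \sum_i quo_scale (a i) x.
Proof.
have addl : {morph (fun a => quo_scale a x) : a b / a + b}.
  move=> b c; rewrite -[c in LHS]opprK quo_scaleBl -sub0r quo_scaleBl.
  by rewrite quo_scale0 sub0r opprK.
exact: (big_morph _ addl (quo_scale0 x)).
Qed.

Lemma gamma_quo_scale a x y : gamma x (quo_scale a y) = quo_scale a (gamma x y).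
Proof.
rewrite /quo_scale; have := gamma_linear x (quo_repr a) y 0.
by rewrite (raddf0 (gamma x)) !addr0.
Qed.

Section Component.
Variable e : idempotent_elt A.
Local Notation ev := (idem_val e).

Lemma componentP x : reflect (quo_scale ev x = x) (x \in component ev).
Proof.
apply: (iffP imsetP) => [[y _ ->]|ex]; first by rewrite -quo_scaleM idemP.
by exists x.
Qed.

Lemma mem_component x : quo_scale ev x \in component ev.
Proof. exact: imset_f. Qed.

Lemma component_gamma x y : y \in component ev -> gamma x y \in component ev.
Proof. by move=> /componentP Cy; apply/componentP; rewrite -gamma_quo_scale Cy. Qed.

Lemma component_addgrp : group_set (to_addgrp (component ev)).
Proof.
apply/addgrp_group_setP; split=> [|x y /componentP Cx /componentP Cy].
  by apply/componentP; rewrite raddf0.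
by apply/componentP; rewrite raddfD /= Cx Cy.
Qed.

Lemma component_subbrace : subbrace (component ev).
Proof.
have aC := component_addgrp; rewrite /subbrace aC /=.
have [C0 CD] := addgrp_group_setP _ aC.
apply/group_setP; split=> [|x y Cx Cy]; first by rewrite brace1E.
by rewrite circE CD ?component_gamma.
Qed.

Definition corner_act (a : corner e) : {additive N -> N} :=
  @quo_scale R N (corner_val a).

Lemma component_submodule : submodule corner_act (component ev).
Proof.
have aC := component_addgrp; have [C0 CD] := addgrp_group_setP _ aC.
split=> // [x y Cx Cy|a x /componentP Cx|x /componentP //].
  by rewrite CD ?addgrp_group_opp.
apply/componentP; rewrite /= -!quo_scaleM mulrC.
by rewrite (eqP (corner_valP a)).
Qed.

Variables (m : ideal (corner e)) (m_max : unique_maximal_ideal m).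
Variables (F : finFieldType) (mF : ring_isomorphic (quo_ring m) F).
Variables (p lambda : nat) (p_pr : prime p) (cardF : #|F| = (p ^ lambda)%N).

Lemma corner_actB (a b : corner e) x :
  corner_act (a - b) x = corner_act a x - corner_act b x.
Proof. exact: quo_scaleBl. Qed.

Lemma corner_actM (a b : corner e) x :
  corner_act (a * b) x = corner_act a (corner_act b x).
Proof. exact: quo_scaleM. Qed.

Lemma component_pnat : (p.-nat #|component ev|)%N.
Proof.
have aC := component_addgrp; set n := #|component ev|.
have n_gt0 : (0 < n)%N by apply/card_gt0P; exists 0; case/addgrp_group_setP: aC.
have ptor : {in component ev, forall x, x *+ p ^ logn p n = 0}.
  apply: (submodule_ptorsion corner_actB corner_actM m_max mF p_pr cardF
            component_submodule (n := n`_p^')).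
    by rewrite prime_coprime // -p'natE // part_pnat.
  move=> x Cx; rewrite -p_part partnC //; apply/eqP.
  by rewrite -addgrp_order_dvd; apply: (@order_dvdG _ (Group aC)).
have : (exponent (Group aC) %| p ^ logn p n)%N.
  by apply/exponentP=> x Cx; rewrite addgrpX ptor.
by move/pnat_dvd => /(_ p); rewrite pnatX pnat_id // pnat_exponent; apply.
Qed.

(** The p-torsion of the component has p^rank elements, too few for the chain of
    submodules in [card_unipotent_submodule] to have length p - 1. *)
Lemma component_torsion :
    (rankZ (to_addgrp (component ev)) < lambda * (p - 1))%N ->
  {in component ev &, forall x y, y *+ p = 0 -> iter (p - 2) (gamma x \- idfun) y = 0}.
Proof.
move=> small x y Cx Cy py0; apply/eqP/negPn/negP=> dy_neq0.
have aC := component_addgrp; have pC := component_pnat.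
have [a aE] := p_natP pC.
pose V := [set z in component ev | z *+ p == 0].
have cardV : #|V| = (p ^ rankZ (to_addgrp (component ev)))%N.
  rewrite -(@card_Ldiv_rankZ _ _ (Group aC)) ?addgrp_abelian //.
  by apply: eq_card => z; rewrite !inE addgrpX.
have sV : submodule corner_act V.
  have [C0 CB CZ C1] := component_submodule; split.
  - by rewrite inE C0 mul0rn eqxx.
  - move=> z w /setIdP[Cz /eqP pz] /setIdP[Cw /eqP pw].
    by rewrite inE CB //= mulrnBl pz pw subrr.
  - by move=> b z /setIdP[Cz /eqP pz]; rewrite inE CZ //= -raddfMn pz raddf0.
  - by move=> z /setIdP[/C1].
have p1E : (p - 2).+1 = (p - 1)%N.
  by case: p (prime_gt1 p_pr) => [|[|q]]; rewrite // !subSS !subn0.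
suff : (#|F| ^ (p - 2).+1 <= #|V|)%N.
  by rewrite p1E cardF cardV -expnM leq_exp2l ?prime_gt1 // leqNgt small.
apply: (card_unipotent_submodule corner_actB corner_actM m_max mF
          (d := gamma x \- idfun) (N := (p ^ a)%N) _ sV _ _ _ dy_neq0).
- by move=> b z; rewrite /= gamma_quo_scale raddfB.
- move=> z /setIdP[Cz /eqP pz].
  have [C0 CB _ _] := component_submodule.
  by rewrite inE CB ?component_gamma //= mulrnBl -(raddfMn (gamma x)) pz raddf0 subrr.
(* gamma_x has order dividing p^a, so (gamma_x - 1)^(p^a) = 0 in characteristic p. *)
- move=> z /setIdP[Cz /eqP pz]; apply: (addrI z); rewrite addr0.
  rewrite -(@iter_Frobenius _ p p_pr (gamma x)) //.
    rewrite -gammaX -aE; have /andP[_ gC] := component_subbrace.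
    have /eqP : (x ^+ #|component ev|)%g == 1%g.
      by rewrite -order_dvdn; apply: (@order_dvdG _ (Group gC)).
    by move=> ->; rewrite gamma1.
  by move=> w; rewrite /= addrC subrK.
by rewrite inE Cy py0 eqxx.
Qed.

Lemma component_order :
    (rankZ (to_addgrp (component ev)) < lambda * (p - 1))%N ->
  {in component ev, forall x : N, #[x : addgrp N]%g = #[x]%g}.
Proof.
move=> small; apply: (order_addgrp_brace p_pr component_subbrace component_pnat).
exact: component_torsion.
Qed.

End Component.

End QuotientAction.

(** * The decomposition into components *)

Section Decomposition.
Variables (R : comPzRingType) (N : finRBrace R) (t : nat).
Variable e : 'I_t -> idempotent_elt (quo_ring (Ann N)).
Hypothesis e_orth : forall i j, i != j -> idem_val (e i) * idem_val (e j) = 0.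
Hypothesis e_sum : \sum_(i < t) idem_val (e i) = 1.
Local Notation proj i := (@quo_scale R N (idem_val (e i))).
Local Notation Ni i := (@component R N (idem_val (e i))).
Implicit Types (x y z : N) (i j : 'I_t).

Lemma proj_id i x : proj i (proj i x) = proj i x.
Proof. by rewrite -quo_scaleM idemP. Qed.

Lemma proj_orth i j x : i != j -> proj i (proj j x) = 0.
Proof. by move=> ij; rewrite -quo_scaleM e_orth // quo_scale0. Qed.

Lemma proj_sum x : \sum_i proj i x = x.
Proof. by rewrite -quo_scale_sum e_sum quo_scale1. Qed.

Lemma proj_eq0 x : (forall i, proj i x = 0) -> x = 0.
Proof. by move=> x0; rewrite -[x]proj_sum big1. Qed.

Lemma component_dprod :
  \big[dprod/1%g]_(i < t) to_addgrp (Ni i) = [set: addgrp N].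
Proof.
pose G i : {group addgrp N} := Group (component_addgrp (e i)).
have /bigdprodYP/eqP defG : forall i, true ->
    ((\prod_(j | true && (j != i)) G j)%G \subset 'C(G i) :\: (G i)^#)%g.
  move=> i _; rewrite subsetD (sub_abelian_cent2 (addgrp_abelian setT)) ?subsetT //=.
  have kerG : group_set (to_addgrp [set x : N | proj i x == 0]).
    apply/addgrp_group_setP; split=> [|x y]; rewrite !inE ?raddf0 //.
    by move=> /eqP x0 /eqP y0; rewrite raddfD /= x0 y0 addr0.
  have sub : ((\prod_(j | j != i) G j)%G \subset Group kerG)%g.
    elim/big_rec: _ => [|j K ji sK]; first exact: sub1G.
    rewrite join_subG sK andbT; apply/subsetP=> x /componentP Cx.
    by rewrite inE -Cx proj_orth // eq_sym.
  rewrite disjoint_subset; apply/subsetP=> x /(subsetP sub).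
  rewrite !inE negb_and negbK => /eqP x0; rewrite orbC -implybE.
  by apply/implyP=> /componentP <-; apply/eqP.
rewrite defG; apply/setP=> x; rewrite inE -[x]proj_sum.
have memG i : (proj i x : addgrp N) \in (\prod_i G i)%G.
  have : G i \subset (\prod_i G i)%G by rewrite (bigD1 i) //= joing_subl.
  by move/subsetP; apply; apply: mem_component.
have [G0 GD] := addgrp_group_setP _ (groupP (\prod_i G i)%G).
by apply: (big_ind [in (\prod_i G i)%G]) => // i _; apply: memG.
Qed.

Hypothesis ideals : forall i, brace_ideal (Ni i).

(** Let c = z^-1 y z, again in N_i by normality, so that y z = z c.  Written with
    gamma this reads y + gamma_y(z) = z + gamma_z(c), where y and gamma_z(c) lie in N_i
    while z and gamma_y(z) lie in the kernel of the projection; comparing the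
    components gives y = gamma_z(c) and gamma_y(z) = z. *)
Lemma gamma_component_ker i y z :
  y \in Ni i -> proj i z = 0 -> gamma y z = z.
Proof.
move=> Cy z0; have [_ _ [_ /andP[_ nC]]] := ideals i.
have Cyz : (y ^ z)%g \in Ni i by rewrite memJ_norm // (subsetP nC) ?inE.
have comm : y + gamma y z = z + gamma z (y ^ z)%g.
  by rewrite -!circE; apply: conjgC.
have := congr1 (proj i) comm.
rewrite (raddfD (proj i) y) (raddfD (proj i) z) /= -!gamma_quo_scale z0.
rewrite (componentP _ _ Cy) (componentP _ _ Cyz) raddf0 addr0 add0r => yE.
by apply: (addrI y); rewrite comm -yE addrC.
Qed.

(** As gamma at e_i x fixes x - e_i x, the sum of these two elements is also their
    circle product. *)
Lemma gamma_split i x z :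
  gamma x z = gamma (proj i x) (gamma (x - proj i x) z).
Proof.
rewrite -gammaM circE (@gamma_component_ker i _ (x - _)) ?mem_component //.
  by rewrite subrKC.
by rewrite raddfB /= proj_id subrr.
Qed.

(** Peeling the components of x other than the i-th off one by one with [gamma_split],
    each acts trivially on N_i by [gamma_component_ker]. *)
Lemma gamma_proj i x y : y \in Ni i -> gamma x y = gamma (proj i x) y.
Proof.
move=> Cy; rewrite (gamma_split i); congr (gamma _ _).
have -> : x - proj i x = \sum_(j <- [seq j <- index_enum 'I_t | j != i]) proj j x.
  by apply: (addrI (proj i x)); rewrite subrKC big_filter -[LHS]proj_sum (bigD1 i).
have : uniq [seq j <- index_enum 'I_t | j != i] by rewrite filter_uniq ?index_enum_uniq.
have : i \notin [seq j <- index_enum 'I_t | j != i] by rewrite mem_filter eqxx.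
elim: [seq j <- _ | _] => [|j s IHs]; first by rewrite big_nil -brace1E gamma1.
rewrite inE negb_or big_cons /= => /andP[ij si] /andP[sj us].
have s0 : proj j (\sum_(k <- s) proj k x) = 0.
  rewrite raddf_sum big_seq big1 // => k sk; rewrite /= proj_orth //.
  by apply: contraNneq sj => ->.
have y0 : proj j y = 0 by rewrite -(componentP _ _ Cy) proj_orth // eq_sym.
rewrite (gamma_split j) (raddfD (proj j) (proj j x)) /=.
rewrite s0 addr0 proj_id addrC addKr IHs //.
exact: gamma_component_ker (mem_component _ _) y0.
Qed.

Lemma projM i x y : proj i (x * y)%g = (proj i x * proj i y)%g.
Proof.
rewrite !circE (raddfD (proj i) x) /= -gamma_quo_scale.
by rewrite (@gamma_proj i x) ?mem_component.
Qed.

Lemma projX i x n : proj i (x ^+ n)%g = (proj i x ^+ n)%g.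
Proof.
elim: n => [|n IHn]; first by rewrite !expg0 brace1E raddf0.
by rewrite !expgS projM IHn.
Qed.

Lemma order_addgrp_brace_total :
    (forall i, {in Ni i, forall x : N, #[x : addgrp N]%g = #[x]%g}) ->
  forall x : N, #[x : addgrp N]%g = #[x]%g.
Proof.
move=> eqo x; have dvdE n : (#[x : addgrp N]%g %| n)%N = (#[x]%g %| n)%N.
  rewrite addgrp_order_dvd brace_order_dvd.
  have eqi i : (proj i x *+ n == 0) = ((proj i x ^+ n)%g == 0).
    by rewrite -addgrp_order_dvd -brace_order_dvd (eqo i) ?mem_component.
  apply/eqP/eqP=> xn; apply: proj_eq0 => i.
    by rewrite projX; apply/eqP; rewrite -eqi -raddfMn xn raddf0.
  by rewrite raddfMn; apply/eqP; rewrite eqi -projX xn raddf0.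
by apply/eqP; rewrite eqn_dvd dvdE dvdnn -dvdE dvdnn.
Qed.

End Decomposition.

Theorem corollary4p12 (R : comPzRingType) (N : finRBrace R) (t : nat)
    (e : 'I_t -> idempotent_elt (quo_ring (Ann N)))
    (he_orth : forall i j : 'I_t, i != j -> idem_val (e i) * idem_val (e j) = 0)
    (he_sum : \sum_(i < t) idem_val (e i) = 1)
    (m : forall i : 'I_t, ideal (corner (e i)))
    (hm : forall i : 'I_t, unique_maximal_ideal (m i))
    (p lambda : 'I_t -> nat)
    (hp : forall i : 'I_t, prime (p i))
    (hres : forall i : 'I_t, exists2 F : finFieldType,
        #|F| = (p i ^ lambda i)%N & ring_isomorphic (quo_ring (m i)) F) :
  let Ni (i : 'I_t) : {set N} := component (idem_val (e i)) in
  let small_rank (i : 'I_t) : Prop :=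
    (rankZ (to_addgrp (Ni i)) < lambda i * (p i - 1))%N in
  [/\ \big[dprod/1%g]_(i < t) to_addgrp (Ni i) = [set: addgrp N],
      forall i : 'I_t, subbrace (Ni i),
      forall i : 'I_t, small_rank i ->
        same_order_counts (to_addgrp (Ni i)) (Ni i) /\
        (abelian (Ni i) -> (to_addgrp (Ni i) \isog Ni i)%g)
    & (forall i : 'I_t, brace_ideal (Ni i)) ->
      (forall i : 'I_t, small_rank i) ->
        same_order_counts [set: addgrp N] [set: N] /\
        (abelian [set: N] -> ([set: addgrp N] \isog [set: N])%g)].
Proof.
move=> Ni small_rank.
have orders i : small_rank i -> {in Ni i, forall x : N, #[x : addgrp N]%g = #[x]%g}.
  have [F cardF mF] := hres i.
  exact: (component_order (hm i) mF (hp i) cardF).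
split=> [|i|i small|ideals small].
- exact: component_dprod.
- exact: component_subbrace.
- exact: same_orders_counts_isog (component_subbrace _) (orders i small).
apply: (@same_orders_counts_isog N [set: N]) => [|x _].
  apply/andP; split; last exact: groupP.
  by apply/addgrp_group_setP; split=> [|y z _ _]; rewrite inE.
apply: (order_addgrp_brace_total he_orth he_sum ideals) => i.
exact: orders.
Qed.
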